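(* Let $\Gamma=(X,E)$ be $J(n,k)$ (with $2k\le n$), $J_q(n,k)$, or $H(n,2)$, and let $\tau,\sigma\in\Omega_1$ be atoms. Then: (i) For $H(n,2)$, $\check\tau\star\check\sigma=\mathbf{0}$. (ii) $\check\tau\star\check\tau=\left(1-\frac{2k}{n}\right)\check\tau$ for $J(n,k)$ and $\check\tau\star\check\tau=\left(1-\frac{2[k]_q}{[n]_q}\right)\check\tau$ for $J_q(n,k)$. (iii) If $\tau\neq\sigma$, then $$\check\tau\star\check\sigma=\begin{cases}\dfrac{2k-n}{n(n-2)}(\check\tau+\check\sigma) & \text{for } J(n,k),\\[6pt] -\dfrac{[k]_q}{[n]_q}(\check\tau+\check\sigma)+\dfrac{[k-1]_q}{q\,[n-2]_q}\displaystyle\sum_{\rho\in\Omega_1,\ \rho\le\tau\vee\sigma}\check\rho & \text{for } J_q(n,k).\end{cases}$$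
   Context: Graphs: (J) Johnson $J(n,k)$, $2k\le n$: vertices the $k$-subsets of $[n]$, adjacent iff $|x\cap y|=k-1$; $d=k$. (G) Grassmann $J_q(n,k)$: $V$ an $n$-dimensional vector space over the field with $q$ elements, vertices the $k$-dimensional subspaces, adjacent iff $\dim(x\cap y)=k-1$; $d=k$. (H) Hypercube $H(n,2)$: vertices $\{1,-1\}^n$, adjacent iff differ in exactly one coordinate; $d=n$. Lattice $\mathbf{L}=\bigcup_{\ell=0}^{d+1}\Omega_\ell$: (J) $\Omega_\ell$ = $\ell$-subsets of $[n]$ ($\ell\le k$), $\Omega_{k+1}=\{\hat 1\}$, ordered by inclusion; join is union if it has $\le k$ elements, else $\hat1$. (G) $\Omega_\ell$ = $\ell$-dimensional subspaces ($\ell\le k$), $\Omega_{k+1}=\{\hat 1\}$, ordered by inclusion; join is $x+y$ if $\dim(x+y)\le k$, else $\hat1$. (H) $\Omega_\ell$ = pairs $(I_x,J_x)$ of disjoint subsets of $[n]$ with $|I_x\cup J_x|=\ell$ ($\ell\le n$), $\Omega_{n+1}=\{\hat1\}$, $x\le y$ iff $I_x\subseteq I_y$, $J_x\subseteq J_y$; $\Omega_n$ identified with $X$. Atoms are the elements of $\Omega_1$. $\iota_z\in\mathbb{R}^X$: $\iota_z(x)=1$ if $z\le x$, else $0$. $\Lambda_j=\mathrm{span}\{\iota_z:z\in\Omega_j\}$, $V_1=\Lambda_1\cap\Lambda_0^\perp$ (orthogonal complement w.r.t. $\langle f,g\rangle=\sum_x f(x)g(x)$), $\pi_1$ the orthogonal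 projection onto $V_1$, $\check\tau=\pi_1(\iota_\tau)$. Norton product on $V_1$: $f\star g=\pi_1(fg)$ with $fg$ the pointwise product. $[i]_q=\frac{q^i-1}{q-1}$ for $i\ge1$ and $[i]_q=0$ for $i<1$. *)

(* Defs.v *)
From HB Require Import structures.
From mathcomp Require Import all_boot all_order all_algebra.

Set Implicit Arguments.
Unset Strict Implicit.
Unset Printing Implicit Defensive.

Import Order.TTheory GRing.Theory Num.Theory.
Import VectorInternalTheory.

Local Open Scope ring_scope.

(* Subspaces of a finite vector space form a finite type. *)
HB.instance Definition _ (F : finFieldType) (V : vectType F) :=
  [Countable of {vspace V} by <:].
HB.instance Definition _ (F : finFieldType) (V : vectType F) :=
  [Finite of {vspace V} by <:].

Record graph := Graph {
  vertex :> finType;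
  adj : rel vertex;
  adj_sym : symmetric adj;
  adj_irr : irreflexive adj }.

(* The finite lattice is given by its joins: the meets follow, as the          *)
(* instances below have a least element. lvertex embeds the vertices as the    *)
(* level Omega_d.                                                              *)
Record graph_lattice := GraphLattice {
  lat_disp : Order.disp_t;
  lat :> finJoinSemilatticeType lat_disp;
  Omega : nat -> {set lat};
  lgraph : graph;
  lvertex : lgraph -> lat }.

Fact lattice_display : Order.disp_t. Proof. exact: Order.Disp tt tt. Qed.

(* The elements of T satisfying P, ordered by le, with a top element None      *)
(* adjoined. As insub z is Some z if P z holds and None otherwise, the join of *)
(* x and y is their join in T if it satisfies P, and the top otherwise.        *)
Section AdjoinTop.
Variables (T : finType) (le : rel T) (join : T -> T -> T) (P : pred T).

Definition with_top := option {x : T | P x}.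

Definition top_le (x y : with_top) : bool :=
  match x, y with
  | _, None => true
  | None, Some _ => false
  | Some a, Some b => le (val a) (val b)
  end.

Definition top_join (x y : with_top) : with_top :=
  if (x, y) is (Some a, Some b) then insub (join (val a) (val b)) else None.

Hypothesis le_refl : reflexive le.
Hypothesis le_anti : antisymmetric le.
Hypothesis le_trans : transitive le.
Hypothesis leUx : forall x y z, le (join x y) z = le x z && le y z.
Hypothesis P_down : forall x y, le x y -> P y -> P x.

Lemma top_le_refl : reflexive top_le.
Proof. by case=> /=. Qed.

Lemma top_le_anti : antisymmetric top_le.
Proof. by case=> [a|] [b|] //= /le_anti/val_inj->. Qed.

Lemma top_le_trans : transitive top_le.
Proof. by case=> [a|] [b|] [c|] //=; apply: le_trans. Qed.

Lemma top_leT x : top_le x None.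
Proof. by case: x. Qed.

Lemma top_leUx x y z : top_le (top_join x y) z = top_le x z && top_le y z.
Proof.
case: z => [c|]; last by rewrite !top_leT.
case: x y => [a|] [b|] //=; rewrite ?andbF //.
rewrite -leUx /top_join; case: insubP => [u _ <- //|/negP nP] /=.
by apply/esym; apply/negP => /P_down/(_ (valP c)).
Qed.

End AdjoinTop.

Section Johnson.
Variables n k : nat.

Definition johnson_vertex := {x : {set 'I_n} | #|x| == k}.

Definition johnson_adj : rel johnson_vertex :=
  fun x y => #|val x :&: val y|.+1 == k.

Lemma johnson_adj_sym : symmetric johnson_adj.
Proof. by move=> x y; rewrite /johnson_adj setIC. Qed.

Lemma johnson_adj_irr : irreflexive johnson_adj.
Proof.
by move=> x; rewrite /johnson_adj setIid (eqP (valP x)) eqn_leq ltnn.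
Qed.

Definition johnson : graph := Graph johnson_adj_sym johnson_adj_irr.

Definition johnson_poset := with_top (fun x : {set 'I_n} => #|x| <= k)%N.

Definition johnson_le : rel johnson_poset :=
  @top_le _ (fun x y : {set 'I_n} => x \subset y) _.

Definition johnson_join : johnson_poset -> johnson_poset -> johnson_poset :=
  @top_join _ (fun x y : {set 'I_n} => x :|: y) _.

Lemma johnson_le_refl : reflexive johnson_le.
Proof. by apply: top_le_refl => x. Qed.

Lemma johnson_le_anti : antisymmetric johnson_le.
Proof. by apply: top_le_anti => x y; rewrite -eqEsubset => /eqP. Qed.

Lemma johnson_le_trans : transitive johnson_le.
Proof. by apply: top_le_trans => y x z; apply: subset_trans. Qed.

HB.instance Definition _ := Finite.on johnson_poset.
HB.instance Definition _ := @Order.Le_isPOrder.Build lattice_display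
  johnson_poset johnson_le johnson_le_refl johnson_le_anti johnson_le_trans.

Lemma johnson_leUx (x y z : johnson_poset) :
  (johnson_join x y <= z)%O = (x <= z)%O && (y <= z)%O.
Proof.
apply: top_leUx => [a b c|a b sab]; first exact: subUset.
exact/leq_trans/subset_leq_card.
Qed.

HB.instance Definition _ := @Order.POrder_isJoinSemilattice.Build
  lattice_display johnson_poset johnson_join johnson_leUx.

Definition johnson_rank (x : johnson_poset) : nat :=
  if x is Some a then #|val a| else k.+1.

Definition johnson_inj (x : johnson) : johnson_poset :=
  Some (Sub (val x) (eq_leq (eqP (valP x)))).

Definition johnson_lattice : graph_lattice :=
  @GraphLattice _ johnson_poset (fun l => [set x | johnson_rank x == l])
    johnson johnson_inj.

End Johnson.

Section Grassmann.
Variables (F : finFieldType) (V : vectType F) (k : nat).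

Definition grassmann_vertex := {x : {vspace V} | \dim x == k}.

Definition grassmann_adj : rel grassmann_vertex :=
  fun x y => (\dim (val x :&: val y)).+1 == k.

Lemma grassmann_adj_sym : symmetric grassmann_adj.
Proof. by move=> x y; rewrite /grassmann_adj capvC. Qed.

Lemma grassmann_adj_irr : irreflexive grassmann_adj.
Proof.
by move=> x; rewrite /grassmann_adj capvv (eqP (valP x)) eqn_leq ltnn.
Qed.

Definition grassmann : graph := Graph grassmann_adj_sym grassmann_adj_irr.

Definition grassmann_poset := with_top (fun x : {vspace V} => \dim x <= k)%N.

Definition grassmann_le : rel grassmann_poset :=
  @top_le _ (fun x y : {vspace V} => x <= y)%VS _.

Definition grassmann_join :
    grassmann_poset -> grassmann_poset -> grassmann_poset :=
  @top_join _ (fun x y : {vspace V} => x + y)%VS _.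

Lemma grassmann_le_refl : reflexive grassmann_le.
Proof. by apply: top_le_refl => x. Qed.

Lemma grassmann_le_anti : antisymmetric grassmann_le.
Proof. by apply: top_le_anti; apply: subv_anti. Qed.

Lemma grassmann_le_trans : transitive grassmann_le.
Proof. by apply: top_le_trans; apply: subv_trans. Qed.

HB.instance Definition _ := Finite.on grassmann_poset.
HB.instance Definition _ := @Order.Le_isPOrder.Build lattice_display
  grassmann_poset grassmann_le
  grassmann_le_refl grassmann_le_anti grassmann_le_trans.

Lemma grassmann_leUx (x y z : grassmann_poset) :
  (grassmann_join x y <= z)%O = (x <= z)%O && (y <= z)%O.
Proof.
apply: top_leUx => [a b c|a b sab]; first exact: subv_add.
exact/leq_trans/dimvS.
Qed.

HB.instance Definition _ := @Order.POrder_isJoinSemilattice.Build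
  lattice_display grassmann_poset grassmann_join grassmann_leUx.

Definition grassmann_rank (x : grassmann_poset) : nat :=
  if x is Some a then \dim (val a) else k.+1.

Definition grassmann_inj (x : grassmann) : grassmann_poset :=
  Some (Sub (val x) (eq_leq (eqP (valP x)))).

Definition grassmann_lattice : graph_lattice :=
  @GraphLattice _ grassmann_poset (fun l => [set x | grassmann_rank x == l])
    grassmann grassmann_inj.

End Grassmann.

Section Hypercube.
Variable n : nat.

(* A vertex of {1, -1}^n is encoded by its signs: coordinate i is              *)
(* (-1) ^+ x i, that is, 1 if x i is false and -1 if x i is true.              *)
Definition hypercube_vertex := {ffun 'I_n -> bool}.

Definition hypercube_adj : rel hypercube_vertex :=
  fun x y => #|[set i | x i != y i]| == 1%N.

Lemma hypercube_adj_sym : symmetric hypercube_adj.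
Proof.
move=> x y; rewrite /hypercube_adj; congr (#|pred_of_set _| == _).
by apply/setP=> i; rewrite !inE eq_sym.
Qed.

Lemma hypercube_adj_irr : irreflexive hypercube_adj.
Proof.
move=> x; rewrite /hypercube_adj (_ : [set i | _] = set0) ?cards0 //.
by apply/setP=> i; rewrite !inE eqxx.
Qed.

Definition hypercube : graph := Graph hypercube_adj_sym hypercube_adj_irr.

Definition hypercube_poset :=
  with_top (fun x : {set 'I_n} * {set 'I_n} => [disjoint x.1 & x.2]).

Definition hypercube_le : rel hypercube_poset :=
  @top_le _ (fun x y : {set 'I_n} * {set 'I_n} =>
               (x.1 \subset y.1) && (x.2 \subset y.2)) _.

Definition hypercube_join :
    hypercube_poset -> hypercube_poset -> hypercube_poset :=
  @top_join _ (fun x y : {set 'I_n} * {set 'I_n} =>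
                 (x.1 :|: y.1, x.2 :|: y.2)) _.

Lemma hypercube_le_refl : reflexive hypercube_le.
Proof. by apply: top_le_refl => x /=; rewrite !subxx. Qed.

Lemma hypercube_le_anti : antisymmetric hypercube_le.
Proof.
apply: top_le_anti => -[x1 x2] [y1 y2] /= /andP[/andP[a b] /andP[c d]].
by congr (_, _); apply/eqP; rewrite eqEsubset ?a ?b.
Qed.

Lemma hypercube_le_trans : transitive hypercube_le.
Proof.
apply: top_le_trans => y x z /= /andP[a b] /andP[c d].
by rewrite (subset_trans a c) (subset_trans b d).
Qed.

HB.instance Definition _ := Finite.on hypercube_poset.
HB.instance Definition _ := @Order.Le_isPOrder.Build lattice_display
  hypercube_poset hypercube_le
  hypercube_le_refl hypercube_le_anti hypercube_le_trans.

Lemma hypercube_leUx (x y z : hypercube_poset) :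
  (hypercube_join x y <= z)%O = (x <= z)%O && (y <= z)%O.
Proof.
apply: top_leUx => [a b c|a b /andP[sab1 sab2]] /=.
  by rewrite !subUset andbACA.
by move=> dis; apply: disjointWl sab1 (disjointWr sab2 dis).
Qed.

HB.instance Definition _ := @Order.POrder_isJoinSemilattice.Build
  lattice_display hypercube_poset hypercube_join hypercube_leUx.

Definition hypercube_rank (x : hypercube_poset) : nat :=
  if x is Some a then #|(val a).1 :|: (val a).2| else n.+1.

Lemma hypercube_inj_subproof (x : hypercube) :
  [disjoint [set i | ~~ x i] & [set i | x i]].
Proof.
by rewrite -setI_eq0; apply/eqP/setP=> i; rewrite !inE; case: (x i).
Qed.

(* The vertex x is the pair of its sets of coordinates equal to 1 and to -1. *)
Definition hypercube_inj (x : hypercube) : hypercube_poset :=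
  Some (exist (fun y : {set 'I_n} * {set 'I_n} => [disjoint y.1 & y.2])
    ([set i | ~~ x i], [set i | x i]) (hypercube_inj_subproof x)).

Definition hypercube_lattice : graph_lattice :=
  @GraphLattice _ hypercube_poset (fun l => [set x | hypercube_rank x == l])
    hypercube hypercube_inj.

End Hypercube.

Section DotProduct.
Variables (R : realFieldType) (X : finType).

(* R^o is R seen as a vector space over itself, so that R^X is a vector space. *)
Definition fdot (f g : {ffun X -> R^o}) : R := \sum_x f x * g x.

Fact fdot_bilinear : bilinear_for
  (GRing.Scale.Law.clone _ _ *%R _) (GRing.Scale.Law.clone _ _ (idfun \; *%R) _)
  fdot.
Proof.
split=> u a x y /=; rewrite /fdot mulr_sumr -big_split /=.
  by apply: eq_bigr => i _; rewrite !ffunE mulrDl -mulrA.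
by apply: eq_bigr => i _; rewrite !ffunE mulrDr mulrCA.
Qed.

HB.instance Definition _ := bilinear_isBilinear.Build R
  {ffun X -> R^o} {ffun X -> R^o} R _ _ fdot fdot_bilinear.

Fact fdot_sym (f g : {ffun X -> R^o}) :
  fdot f g = (-1) ^+ false * idfun (fdot g f).
Proof. by rewrite mul1r; apply: eq_bigr => i _; rewrite mulrC. Qed.

HB.instance Definition _ := isHermitianSesquilinear.Build R
  {ffun X -> R^o} false idfun fdot fdot_sym.

Fact fdot_gt0 (f : {ffun X -> R^o}) : f != 0 -> 0 < fdot f f.
Proof.
move=> fN0; rewrite lt_neqAle sumr_ge0 ?andbT => [|x _]; last exact: sqr_ge0.
apply: contra_neq fN0 => /esym/psumr_eq0P f0.
apply/ffunP=> x; rewrite ffunE; apply/eqP; rewrite -sqrf_eq0.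
by apply/eqP/f0 => // y _; exact: sqr_ge0.
Qed.

HB.instance Definition _ := isDotProduct.Build R {ffun X -> R^o} fdot fdot_gt0.

Implicit Types (f g : {ffun X -> R^o}) (U : {vspace {ffun X -> R^o}}).

Definition forth U : {vspace {ffun X -> R^o}} := orthov (@fdot) U.

Definition orth_proj U f : {ffun X -> R^o} := daddv_pi U (forth U) f.

Lemma mem_forthP U f :
  reflect (forall g, g \in U -> fdot f g = 0) (f \in forth U).
Proof. exact: mem_orthovP. Qed.

Lemma cap_forth U : (U :&: forth U = 0)%VS.
Proof.
apply/eqP; rewrite -subv0; apply/subvP=> f; rewrite memv_cap memv0.
case/andP=> fU /mem_forthP/(_ f fU) ff0; apply: contraT => /fdot_gt0.
by rewrite ff0 ltxx.
Qed.

Lemma add_forth U : (U + forth U = fullv)%VS.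
Proof.
pose h f := [ffun i : 'I_(\dim U) => fdot f (vbasis U)`_i : R^o].
have hlin : linear h by move=> a f g; apply/ffunP=> i; rewrite !ffunE linearPl.
pose hL : {linear _ -> _} := HB.pack h (GRing.isLinear.Build _ _ _ _ h hlin).
have ker_sub : (lker (linfun hL) <= forth U)%VS.
  apply/subvP=> f; rewrite memv_ker lfunE /= => /eqP hf0.
  apply/mem_forthP => g /coord_vbasis ->.
  rewrite linear_sumr big1 // => i _; rewrite linearZr_LR /=.
  by have /ffunP/(_ i) := hf0; rewrite !ffunE => ->; rewrite mulr0.
apply/eqP; rewrite eqEdim subvf /= dimv_disjoint_sum ?cap_forth //.
rewrite -(limg_ker_dim (linfun hL) fullv) capfv addnC leq_add ?dimvS //.
by rewrite (leq_trans (dimvS (subvf _))) // dimvf /dim /= card_ord muln1.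
Qed.

Lemma orth_projP U f : orth_proj U f \in U /\ f - orth_proj U f \in forth U.
Proof.
split; first exact: memv_pi.
have := daddv_pi_add (w := f) (cap_forth U).
rewrite add_forth memvf => /(_ isT) {1}<-.
by rewrite addrC addKr memv_pi.
Qed.

End DotProduct.

Section Norton.
Variables (R : realFieldType) (L : graph_lattice).

Local Notation fnX := {ffun lgraph L -> R^o}.

Definition iotaf (z : L) : fnX := [ffun x => (z <= lvertex x)%O%:R].

Definition Lambda (l : nat) : {vspace fnX} :=
  <<[seq iotaf z | z in Omega L l]>>%VS.

Definition V1 : {vspace fnX} := (Lambda 1 :&: forth (Lambda 0))%VS.

Definition pi1 (f : fnX) : fnX := orth_proj V1 f.

Definition check (z : L) : fnX := pi1 (iotaf z).

Definition norton (f g : fnX) : fnX := pi1 [ffun x => f x * g x].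

End Norton.

(* The q-number [i]_q, which vanishes for i < 1; i may be negative. *)
Definition qint (R : realFieldType) (q : R) (i : int) : R :=
  if 1 <= i then (q ^ i - 1) / (q - 1) else 0.

(* Main.v *)
Require Import Defs.
From mathcomp Require Import all_boot all_order all_algebra all_field.
From mathcomp Require Import reals ring lra zify.
Import GRing.Theory Num.Theory Order.TTheory.
Local Open Scope ring_scope.

Set Implicit Arguments.
Unset Strict Implicit.
Unset Printing Implicit Defensive.

(* As Lambda_0 is the line of constant functions, pi_1 kills every g whose
   inner products with the functions iota_mu (mu an atom) all agree. So checking
   an atom subtracts from iota_tau the constant a = K/N, where every vertex is
   above K of the N atoms. Expanding, iota_tau^2 = iota_tau gives (ii), while
   iota_tau iota_sigma = iota_(tau v sigma) reduces (iii) to projecting the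
   latter. If N2 (resp. N3) vertices are above two atoms (resp. above tau,
   sigma, and an atom not below tau v sigma) and m atoms are below tau v sigma,
   double counting gives (N-1) N2 = (K-1) N1 and (N-m) N3 = (K-m) N2, whence
   pi_1 iota_(tau v sigma) = (K-1)/(N-m) times the sum of the checked atoms
   below tau v sigma, for both families. For the hypercube, a checked atom is
   half a coordinate up to sign, and sign changes of a coordinate do the rest. *)

(** * Orthogonal projection of functions on a finite set *)

Section OrthogonalProjection.
Variables (R : realFieldType) (X : finType).
Implicit Types (U : {vspace {ffun X -> R^o}}) (f g u : {ffun X -> R^o}).

Lemma fdotC f g : fdot f g = fdot g f.
Proof. by apply: eq_bigr => x _; rewrite mulrC. Qed.

(** Two candidates for the projection differ by a vector of [U] that is also orthogonal to [U],
    hence 0. *)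
Lemma orth_proj_eq U f u :
  u \in U -> f - u \in forth U -> orth_proj U f = u.
Proof.
move=> uU fuU; have [pU fpU] := orth_projP U f.
apply/eqP; rewrite -subr_eq0 -memv0 -(cap_forth U) memv_cap rpredB //=.
have -> : orth_proj U f - u = (f - u) - (f - orth_proj U f).
  by rewrite opprB [RHS]addrC addrA subrK.
exact: rpredB.
Qed.

Lemma orth_projD U f g : orth_proj U (f + g) = orth_proj U f + orth_proj U g.
Proof. exact: linearD. Qed.

Lemma orth_projZ U a f : orth_proj U (a *: f) = a *: orth_proj U f.
Proof. exact: linearZ. Qed.

End OrthogonalProjection.

(** * The projection [pi1] and the checked atoms of a graph lattice *)

Section NortonAlgebra.
Variables (R : realFieldType) (L : graph_lattice).
Local Notation fnX := {ffun lgraph L -> R^o}.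
Local Notation iota := (iotaf R).
Implicit Types (f g : fnX) (a c : R) (mu rho : L).

Definition cst a : fnX := [ffun => a].

Lemma scaleffE a f x : (a *: f) x = a * f x.
Proof. by rewrite ffunE. Qed.

Lemma pi1D f g : pi1 (f + g) = pi1 f + pi1 g.
Proof. exact: orth_projD. Qed.

Lemma pi1Z a f : pi1 (a *: f) = a *: pi1 f.
Proof. exact: orth_projZ. Qed.

Lemma pi1_0 : pi1 (0 : fnX) = 0.
Proof. by rewrite -[X in pi1 X](scale0r (0 : fnX)) pi1Z scale0r. Qed.

Lemma pi1_sum (I : Type) (r : seq I) (P : pred I) (F : I -> fnX) :
  pi1 (\sum_(i <- r | P i) F i) = \sum_(i <- r | P i) pi1 (F i).
Proof. exact: (big_morph _ pi1D pi1_0). Qed.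

(** Meant for the adjoined top: it lies below no vertex, yet has rank 1 when [k = 0] (for the
    hypercube, when [n = 0]). *)
Lemma check_iota0 mu : iota mu = 0 -> check R mu = 0.
Proof. by rewrite /check => ->; rewrite pi1_0. Qed.

Lemma norton0f f : norton (0 : fnX) f = 0.
Proof.
rewrite /norton -[RHS]pi1_0; congr (pi1 _); apply/ffunP => x.
by rewrite !ffunE mul0r.
Qed.

Lemma fdotBl f g h : fdot (f - g) h = fdot f h - fdot g h.
Proof. exact: linearBl. Qed.

Lemma fdotZl a f h : fdot (a *: f) h = a * fdot f h.
Proof. by rewrite /fdot mulr_sumr; apply: eq_bigr => x _; rewrite scaleffE mulrA. Qed.

Lemma fdot_suml (I : Type) (r : seq I) (P : pred I) (F : I -> fnX) h :
  fdot (\sum_(i <- r | P i) F i) h = \sum_(i <- r | P i) fdot (F i) h.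
Proof.
rewrite /fdot exchange_big; apply: eq_bigr => x _.
by rewrite sum_ffunE mulr_suml.
Qed.

Lemma fdot_sumr (I : Type) (r : seq I) (P : pred I) (F : I -> fnX) h :
  fdot h (\sum_(i <- r | P i) F i) = \sum_(i <- r | P i) fdot h (F i).
Proof. by rewrite fdotC fdot_suml; apply: eq_bigr => i _; rewrite fdotC. Qed.

Lemma iota_mem_Lambda l mu : mu \in Omega L l -> iota mu \in Lambda R L l.
Proof. by move=> muA; apply/memv_span/map_f; rewrite mem_enum. Qed.

Lemma iota_sq mu x : iota mu x * iota mu x = iota mu x.
Proof. by rewrite !ffunE; case: (_ <= _)%O; rewrite ?mulr1 ?mulr0. Qed.

Lemma fdot_cst1 f : fdot (cst 1) f = \sum_x f x.
Proof. by apply: eq_bigr => x _; rewrite ffunE mul1r. Qed.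

(** The functions orthogonal to [h] form a subspace, so containing the generators suffices. *)
Lemma forth_Lambda h l :
  (forall mu, mu \in Omega L l -> fdot h (iota mu) = 0) ->
  h \in forth (Lambda R L l).
Proof.
move=> h0; suff /subvP sub : (Lambda R L l <= forth <[h]>)%VS.
  apply/mem_forthP => f /sub /mem_forthP/(_ h); rewrite fdotC; apply.
  exact: memv_line.
apply/span_subvP => f /mapP[mu]; rewrite mem_enum => /h0 muA ->.
apply/mem_forthP => _ /vlineP[a ->].
by rewrite fdotC fdotZl muA mulr0.
Qed.

Lemma Lambda0_eq z0 : z0 \in Omega L 0 ->
  (forall z x, z \in Omega L 0 -> (z <= lvertex x)%O) ->
  Lambda R L 0 = <[cst 1]>%VS.
Proof.
move=> z0P leP; have iota1 z : z \in Omega L 0 -> iota z = cst 1.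
  by move=> zP; apply/ffunP => x; rewrite !ffunE leP.
apply/eqP; rewrite eqEsubv -memvE -(iota1 z0) // iota_mem_Lambda // andbT.
apply/span_subvP => f /mapP[z]; rewrite mem_enum => zP ->.
by rewrite (iota1 z) // -(iota1 z0) // memv_line.
Qed.

Lemma fdot_iota_card mu nu :
  fdot (iota mu) (iota nu)
    = #|[set x | (mu <= @lvertex L x)%O && (nu <= lvertex x)%O]|%:R.
Proof.
rewrite -sum1_card natr_sum big_mkcond; apply: eq_bigr => x _.
by rewrite !ffunE inE -natrM mulnb; case: andb.
Qed.

Lemma fdot1_iota_card mu :
  fdot (cst 1) (iota mu) = #|[set x | (mu <= @lvertex L x)%O]|%:R.
Proof.
rewrite -sum1_card natr_sum big_mkcond; apply: eq_bigr => x _.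
by rewrite !ffunE inE mul1r; case: (_ <= _)%O.
Qed.

Lemma sum_iota_card K :
  (forall x, #|[set mu in Omega L 1 | (mu <= lvertex x)%O]|%:R = K) ->
  \sum_(mu in Omega L 1) iota mu = cst K.
Proof.
move=> KP; apply/ffunP => x; rewrite sum_ffunE ffunE -(KP x) -sum1_card natr_sum.
under [RHS]eq_bigl do rewrite inE.
rewrite big_mkcondr; apply: eq_bigr => mu _.
by rewrite ffunE; case: (_ <= _)%O.
Qed.

Hypothesis Lambda0 : Lambda R L 0 = <[cst 1]>%VS.

(** Functions in [V1] lie in [Lambda 1] and are orthogonal to constants. As [g - c] is orthogonal to
    [Lambda 1], [g] is orthogonal to [V1]. *)
Lemma pi1_forth g c :
  (forall mu, mu \in Omega L 1 -> fdot g (iota mu) = c * fdot (cst 1) (iota mu)) ->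
  pi1 g = 0.
Proof.
move=> gc; apply: orth_proj_eq; first exact: mem0v.
rewrite subr0; apply/mem_forthP => f; rewrite memv_cap => /andP[f1 f0].
have fdot1 : fdot (cst 1) f = 0.
  by move/mem_forthP: f0; rewrite Lambda0 fdotC; apply; apply: memv_line.
have /mem_forthP/(_ f f1) : g - c *: cst 1 \in forth (Lambda R L 1).
  by apply: forth_Lambda => mu /gc gmu; rewrite fdotBl fdotZl gmu subrr.
by rewrite fdotBl fdotZl fdot1 mulr0 subr0.
Qed.

Lemma pi1_cst a : pi1 (cst a) = 0.
Proof.
apply: (@pi1_forth _ a) => mu _; rewrite -fdotZl; congr fdot.
by apply/ffunP => x; rewrite !ffunE [RHS]mulr1.
Qed.

(** With [a] the mean of [iota mu], the difference is orthogonal to constants; [cst a] being in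
    [Lambda 1] keeps it in [V1]. *)
Lemma check_eq a mu : mu \in Omega L 1 ->
  cst a \in Lambda R L 1 -> fdot (cst 1) (iota mu) = a * #|lgraph L|%:R ->
  check R mu = iota mu - cst a.
Proof.
move=> muA aL eqa; rewrite /check -[iota mu in LHS](subrK (cst a)) pi1D pi1_cst.
rewrite addr0; apply: orth_proj_eq; last by rewrite subrr mem0v.
rewrite memv_cap rpredB ?iota_mem_Lambda //=; apply/mem_forthP => g.
rewrite Lambda0 => /vlineP[b ->]; rewrite fdotC fdotZl fdotC fdotBl fdotC eqa.
rewrite [fdot (cst a) _]fdotC fdot_cst1 (eq_bigr (fun=> a)); last first.
  by move=> x _; rewrite ffunE.
by rewrite sumr_const mulr_natr subrr mulr0.
Qed.

(** * Lattices in which all atoms lie below equally many vertices *)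

Section ConstantDegree.
Variable N1 : R.
Hypothesis fdot_iota : forall mu, mu \in Omega L 1 ->
  fdot (cst 1) (iota mu) = N1.

Lemma pi1_const g C :
  (forall mu, mu \in Omega L 1 -> fdot g (iota mu) = C) -> pi1 g = 0.
Proof.
move=> gC; apply: (@pi1_forth _ (C / N1)) => mu muA.
(* If [N1 = 0], then [iota mu], whose square norm is [N1], vanishes and both sides are 0. *)
rewrite (fdot_iota muA); have [N0|N_neq0] := eqVneq N1 0; last first.
  by rewrite gC // divfK.
suff -> : iota mu = 0.
  by rewrite N0 mulr0 /fdot big1 // => x _; rewrite ffunE mulr0.
apply: contraTeq isT => /fdot_gt0.
suff -> : fdot (iota mu) (iota mu) = N1 by rewrite N0 ltxx.
by rewrite -(fdot_iota muA) fdot_cst1; apply: eq_bigr => x _; rewrite iota_sq.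
Qed.

Variable K : R.
Hypothesis sum_iota : \sum_(mu in Omega L 1) iota mu = cst K.

Local Notation N := (#|Omega L 1|%:R : R).
Local Notation a := (K / N).

Lemma natr_card_neq0 (T : finType) (A : {set T}) x : x \in A -> #|A|%:R != 0 :> R.
Proof. by move=> xA; rewrite pnatr_eq0 -lt0n; apply/card_gt0P; exists x. Qed.

Lemma check_regular mu : mu \in Omega L 1 -> check R mu = iota mu - cst a.
Proof.
move=> muA; have N0 := natr_card_neq0 muA; apply: check_eq => //.
  suff -> : cst a = N^-1 *: cst K.
    rewrite rpredZ // -sum_iota rpred_sum // => nu; exact: iota_mem_Lambda.
  by apply/ffunP => x; rewrite scaleffE !ffunE mulrC.
(* Both sides count the pairs of an atom and a vertex above it, so [K / N] is the mean of
   [iota mu]. *)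
have key : N * N1 = K * #|lgraph L|%:R.
  have -> : N * N1 = fdot (cst 1) (cst K).
    by rewrite -sum_iota fdot_sumr (eq_bigr (fun=> N1)) ?sumr_const ?mulr_natl.
  rewrite fdot_cst1 (eq_bigr (fun=> K)) ?sumr_const ?mulr_natr // => x _.
  by rewrite ffunE.
by rewrite fdot_iota // mulrAC -key mulrC mulKf.
Qed.

(** Pointwise, [(iota - a)^2 = (1 - 2a) iota + a^2], and the projection kills the constant. *)
Lemma norton_check_sq mu : mu \in Omega L 1 ->
  norton (check R mu) (check R mu) = (1 - 2 * a) *: check R mu.
Proof.
move=> muA; rewrite {1 2}check_regular // /norton /check -pi1Z.
rewrite -[RHS]addr0 -(pi1_cst (a ^+ 2)) -pi1D; congr pi1; apply/ffunP => x.
rewrite [RHS]ffunE scaleffE; have := iota_sq mu x.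
rewrite !ffunE; set i : R := (_ <= _)%O%:R => ii; ring: ii.
Qed.

(** * The product of two distinct checked atoms *)

Section Pair.
Variables (tau sigma : L) (N2 N3 : R).
Hypotheses (tauA : tau \in Omega L 1) (sigmaA : sigma \in Omega L 1).
Hypothesis tau_neq_sigma : tau != sigma.
Local Notation j := (tau `|` sigma)%O.
Hypothesis fdot_iota2 : forall mu nu, mu \in Omega L 1 -> nu \in Omega L 1 ->
  mu != nu -> fdot (iota mu) (iota nu) = N2.
Hypothesis fdot_iota3 : forall rho, rho \in Omega L 1 -> ~~ (rho <= j)%O ->
  fdot (iota j) (iota rho) = N3.

Lemma iota_join x : iota j x = iota tau x * iota sigma x.
Proof. by rewrite !ffunE leUx -natrM mulnb. Qed.

(** Every term is [N2], except the diagonal one, present when [mu] is in [B], which is [N1] by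
    idempotence. *)
Lemma sum_fdot_iota (B : {set L}) mu : mu \in Omega L 1 -> B \subset Omega L 1 ->
  \sum_(rho in B) fdot (iota rho) (iota mu)
    = #|B|%:R * N2 + (mu \in B)%:R * (N1 - N2).
Proof.
move=> muA /subsetP BA.
have term rho : rho \in B ->
    fdot (iota rho) (iota mu) = N2 + (rho == mu)%:R * (N1 - N2).
  move=> /BA rhoA; have [->|rho_mu] := eqVneq rho mu; last first.
    by rewrite mul0r addr0 fdot_iota2.
  rewrite mul1r addrC subrK -(fdot_iota muA) fdot_cst1.
  by apply: eq_bigr => x _; rewrite iota_sq.
rewrite (eq_bigr _ term) big_split sumr_const mulr_natl; congr (_ + _).
rewrite -mulr_suml; congr (_ * _); have [muB|muB] := boolP (mu \in B).
  rewrite (bigD1 mu) //= eqxx big1 ?addr0 // => rho /andP[_ /negPf->] //.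
by rewrite big1 // => rho rhoB; case: eqP muB => // <-; rewrite rhoB.
Qed.

Lemma fdot_cstK f : fdot f (cst K) = K * fdot (cst 1) f.
Proof.
by rewrite fdot_cst1 mulr_sumr; apply: eq_bigr => x _; rewrite ffunE mulrC.
Qed.

(** Pairing [iota tau] with the sum [K] of all [iota mu] gives [K * N1 = N1 + (N - 1) * N2]. *)
Lemma degree2E : (N - 1) * N2 = (K - 1) * N1.
Proof.
have := sum_fdot_iota tauA (subxx _).
under eq_bigr do rewrite fdotC.
rewrite -fdot_sumr sum_iota fdot_cstK fdot_iota // tauA mul1r => e.
rewrite [RHS]mulrBl e; ring.
Qed.

Let B := [set rho in Omega L 1 | (rho <= j)%O].
Local Notation m := (#|B|%:R : R).

Let BA : B \subset Omega L 1.
Proof. by apply/subsetP => rho; rewrite inE => /andP[]. Qed.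

(** A vertex above the join is already above [rho], so only [tau] and [sigma] constrain it. *)
Let fdot_join rho : rho \in B -> fdot (iota j) (iota rho) = N2.
Proof.
rewrite inE => /andP[rhoA rho_le].
rewrite -(fdot_iota2 tauA sigmaA tau_neq_sigma); apply: eq_bigr => x _.
rewrite -iota_join !ffunE; case: (boolP (j <= _)%O) => [jx|]; last by rewrite mul0r.
by rewrite (le_trans rho_le jx) mulr1.
Qed.

(** Pairing [iota j] with the sum [K]: each atom of [B] contributes [N2], each of the other [N - m]
    contributes [N3]. *)
Lemma degree3E : (N - m) * N3 = (K - m) * N2.
Proof.
have e : fdot (iota j) (cst K) = m * N2 + (N - m) * N3.
  rewrite -sum_iota fdot_sumr (big_setID B) /=; congr (_ + _).
    rewrite (setIidPr BA) (eq_bigr _ (fun rho => @fdot_join rho)).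
    by rewrite sumr_const mulr_natl.
  rewrite (eq_bigr (fun=> N3)) => [|rho]; last first.
    rewrite !inE negb_and => /andP[/orP[/negP//|rj] rhoA]; exact: fdot_iota3.
  rewrite sumr_const -[LHS]mulr_natl; congr (_ * _).
  by rewrite -(cardsID B (Omega L 1)) (setIidPr BA) natrD addrC addKr.
rewrite fdot_cstK in e; have eN2 : fdot (cst 1) (iota j) = N2.
  rewrite -(fdot_iota2 tauA sigmaA tau_neq_sigma) fdot_cst1.
  by apply: eq_bigr => x _; rewrite iota_join.
rewrite eN2 in e; rewrite [RHS]mulrBl e; ring.
Qed.

(* The coefficient makes the inner product with [iota rho] the same for atoms
   [rho] below and not below the join; if all atoms are below it, i.e. [N = m],
   any coefficient would do, including the value [0] of the division. *)
Lemma pi1_iota_join : pi1 (iota j)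
  = (K - 1) / (N - m) *: \sum_(rho in Omega L 1 | (rho <= j)%O) check R rho.
Proof.
set c := _ / _; apply/eqP; rewrite -subr_eq0; apply/eqP.
have sumB (F : L -> fnX) :
    \sum_(rho in Omega L 1 | (rho <= j)%O) F rho = \sum_(rho in B) F rho.
  by apply: eq_bigl => rho; rewrite inE.
rewrite sumB -pi1_sum -scaleNr -pi1Z -pi1D scaleNr.
(* The constant is the inner product of the difference with [iota mu] for [mu] in [B]. *)
apply: (@pi1_const _ (N2 - c * (m * N2 + (N1 - N2)))) => mu muA.
rewrite fdotBl fdotZl fdot_suml sum_fdot_iota //.
have [muB|muB] := boolP (mu \in B); first by rewrite mul1r fdot_join.
have Nm : N - m != 0.
  rewrite -(cardsID B (Omega L 1)) (setIidPr BA) natrD addrC addKr.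
  by apply: (@natr_card_neq0 _ _ mu); rewrite inE muB.
have N1' : N - 1 != 0.
  rewrite (cardsD1 tau (Omega L 1)) tauA natrD [1%:R + _]addrC addrK.
  by apply: (@natr_card_neq0 _ _ sigma); rewrite !inE eq_sym tau_neq_sigma.
rewrite fdot_iota3 //; last by apply: contra muB; rewrite inE muA.
(* What is left amounts to [c * (N1 - N2) = N2 - N3]; the two double counts reduce it to [N1]. *)
have eN3 : N3 = (K - m) * N2 / (N - m) by rewrite -degree3E mulrC mulKf.
have eN2 : N2 = (K - 1) * N1 / (N - 1) by rewrite -degree2E mulrC mulKf.
rewrite eN3 /c mul0r eN2; field; exact/andP.
Qed.

(** Pointwise, the product is [iota j - a (iota tau + iota sigma) + a^2]. *)
Lemma norton_check_pair : norton (check R tau) (check R sigma)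
  = - a *: (check R tau + check R sigma)
    + (K - 1) / (N - m)
        *: \sum_(rho in Omega L 1 | (rho <= j)%O) check R rho.
Proof.
rewrite -pi1_iota_join [in LHS](check_regular tauA) [in LHS](check_regular sigmaA).
rewrite /norton /check.
rewrite -pi1D -pi1Z -pi1D -[RHS]addr0 -(pi1_cst (a ^+ 2)) -pi1D.
congr pi1; apply/ffunP => x.
rewrite [RHS]ffunE [X in _ = X + _]ffunE scaleffE iota_join !ffunE; ring.
Qed.

End Pair.
End ConstantDegree.
End NortonAlgebra.

(** * Hypercube: coordinate functions and sign changes *)

Section Hypercube.
Variables (R : realFieldType) (n : nat).
Local Notation L := (hypercube_lattice n).
Implicit Types (i j : 'I_n) (b : bool) (x : hypercube n).

(** As [true] encodes the coordinate -1, it puts [i] in the second set; the atom then lies below the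
    vertices with [x i = b]. *)
Definition hypercube_pair i b : {set 'I_n} * {set 'I_n} :=
  if b then (set0, [set i]) else ([set i], set0).

Fact hypercube_pair_disjoint i b :
  [disjoint (hypercube_pair i b).1 & (hypercube_pair i b).2].
Proof. by rewrite -setI_eq0; case: b; rewrite /= ?set0I ?setI0. Qed.

Definition hypercube_atom i b : L :=
  Some (exist (fun y : {set 'I_n} * {set 'I_n} => [disjoint y.1 & y.2])
    (hypercube_pair i b) (hypercube_pair_disjoint i b)).

Lemma hypercube_le_vertex (a : {y : {set 'I_n} * {set 'I_n} | [disjoint y.1 & y.2]}) x :
  ((Some a : L) <= @lvertex L x)%O
    = ((val a).1 \subset [set i | ~~ x i]) && ((val a).2 \subset [set i | x i]).
Proof. by []. Qed.

Lemma hypercube_atom_le i b x :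
  (hypercube_atom i b <= @lvertex L x)%O = (x i == b).
Proof.
rewrite hypercube_le_vertex /=.
by case: b; rewrite /= sub0set sub1set inE ?andbT; case: (x i).
Qed.

Lemma hypercube_atom_Omega i b : hypercube_atom i b \in Omega L 1.
Proof.
by rewrite inE /hypercube_rank /=; case: b; rewrite /= ?set0U ?setU0 cards1.
Qed.

(** The top has rank [n + 1], so [None] occurs only for [n = 0]. Otherwise the two sets are disjoint
    with union a singleton, and exactly one of them is empty. *)
Lemma hypercube_Omega1P (mu : L) : mu \in Omega L 1 ->
  mu = None \/ exists i b, mu = hypercube_atom i b.
Proof.
case: mu => [[[I J] /= dIJ]|]; last by left.
rewrite inE /= => /cards1P[i eIJ]; right; exists i.
have sub (A : {set 'I_n}) :
    A \subset I :|: J -> A = if i \in A then [set i] else set0.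
  by rewrite eIJ subset1 => /orP[]/eqP->; rewrite ?set11 ?inE.
have eI := sub I (subsetUl I J); have eJ := sub J (subsetUr I J).
have : i \in I :|: J by rewrite eIJ set11.
rewrite inE; case: (boolP (i \in I)) => [iI _|iI /= iJ].
  exists false; congr Some; apply/val_inj => /=; rewrite /hypercube_pair.
  by rewrite {1}eI {1}eJ iI (disjointFr dIJ iI).
exists true; congr Some; apply/val_inj => /=; rewrite /hypercube_pair.
by rewrite {1}eI {1}eJ (negPf iI) iJ.
Qed.

Lemma hypercube_Lambda0 : Lambda R L 0 = <[cst L (1 : R)]>%VS.
Proof.
have d0 : [disjoint (set0 : {set 'I_n}) & (set0 : {set 'I_n})].
  by rewrite -setI_eq0 set0I.
pose z0 : L := Some (exist (fun y : {set 'I_n} * {set 'I_n} => [disjoint y.1 & y.2])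
  (set0, set0) d0).
apply: (@Lambda0_eq _ _ z0); first by rewrite inE /= setU0 cards0.
case=> [[[I J] dIJ]|] x; rewrite inE //= cards_eq0 setU_eq0 => /andP[/eqP I0 /eqP J0].
by rewrite hypercube_le_vertex /= I0 J0 !sub0set.
Qed.

Definition flip i x : hypercube n := [ffun j => x j (+) (j == i)].

Lemma flipK i : involutive (flip i).
Proof. by move=> x; apply/ffunP => j; rewrite !ffunE -addbA addbb addbF. Qed.

(** A flip permutes the vertices, so the sum equals its own negative. *)
Lemma sum_flip_opp (g : hypercube n -> R) i :
  (forall x, g (flip i x) = - g x) -> \sum_x g x = 0.
Proof.
move=> gN; suff : \sum_x g x = - \sum_x g x by move=> e; lra.
rewrite {1}(reindex_inj (inv_inj (flipK i))) -sumrN.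
by apply: eq_bigr => x _; rewrite gN.
Qed.

(** Half of the coordinate [i] as a number 1 or -1, negated if [b] is true. *)
Definition halfsign i b x : R := (x i == b)%:R - 2^-1.

Lemma halfsign_flip i b x : halfsign i b (flip i x) = - halfsign i b x.
Proof.
by rewrite /halfsign ffunE eqxx; case: (x i) b => -[] /=; lra.
Qed.

Lemma halfsign_flip_neq i j b x : i != j ->
  halfsign j b (flip i x) = halfsign j b x.
Proof. by move=> ij; rewrite /halfsign ffunE [j == i]eq_sym (negPf ij) addbF. Qed.

(** Half of the vertices lie above the atom, and the constant 1/2 is half the sum of the two
    opposite atoms. *)
Lemma check_hypercube_atom i b x :
  check R (hypercube_atom i b) x = halfsign i b x.
Proof.
rewrite (@check_eq _ _ hypercube_Lambda0 2^-1) ?hypercube_atom_Omega //.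
- by rewrite !ffunE hypercube_atom_le.
- suff -> : cst L (2^-1 : R) = 2^-1 *: (iotaf R (hypercube_atom i true)
                                  + iotaf R (hypercube_atom i false)).
    by rewrite rpredZ // rpredD // iota_mem_Lambda ?hypercube_atom_Omega.
  apply/ffunP => y; rewrite scaleffE !ffunE !hypercube_atom_le.
  by case: (y i); rewrite ?addr0 ?add0r mulr1.
- apply/eqP; rewrite -subr_eq0 fdot_cst1; apply/eqP.
  rewrite -[RHS](@sum_flip_opp (halfsign i b) i); last exact: halfsign_flip.
  rewrite /halfsign [RHS]big_split /= sumr_const mulNrn mulr_natr.
  by congr (_ - _); apply: eq_bigr => y _; rewrite ffunE hypercube_atom_le.
Qed.

Lemma norton_check_hypercube (tau sigma : L) :
  tau \in Omega L 1 -> sigma \in Omega L 1 ->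
  norton (check R tau) (check R sigma) = 0.
Proof.
have iotaN : iotaf R (None : L) = 0 by apply/ffunP => x; rewrite !ffunE.
move=> /hypercube_Omega1P[->|[i [b ->]]].
  by rewrite check_iota0 // norton0f.
move=> /hypercube_Omega1P[->|[j [b' ->]]].
  rewrite [check R (None : L)]check_iota0 // /norton -[RHS](pi1_0 R L).
  by congr pi1; apply/ffunP => x; rewrite !ffunE mulr0.
rewrite /norton (_ : [ffun x => _] = [ffun x => halfsign i b x * halfsign j b' x]);
  last by apply/ffunP => x; rewrite !ffunE !check_hypercube_atom.
(* On a single coordinate the product is the constant 1/4 or -1/4. *)
have [<-|ij] := eqVneq i j.
  rewrite -[RHS](pi1_cst hypercube_Lambda0 ((-1) ^+ (b != b') / 4)); congr pi1.
  apply/ffunP => x; rewrite !ffunE /halfsign.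
  by case: (x i) b b' => -[] [] /=; field.
apply: (pi1_forth hypercube_Lambda0 (c := 0)) => mu muA; rewrite mul0r /fdot.
case: (hypercube_Omega1P muA) => [->|[k [b'' ->]]].
  by rewrite iotaN big1 // => x _; rewrite !ffunE mulr0.
have ji : j != i by rewrite eq_sym.
(* Flip one of [i], [j] that differs from the coordinate [k] of [mu]: the product changes sign,
   [iota mu] does not. *)
have [->|ki] := eqVneq k i.
  apply: (@sum_flip_opp _ j) => x; rewrite !ffunE !hypercube_atom_le.
  rewrite halfsign_flip (halfsign_flip_neq _ _ ji) ffunE (negPf ij) addbF.
  by rewrite mulrN mulNr.
apply: (@sum_flip_opp _ i) => x; rewrite !ffunE !hypercube_atom_le.
by rewrite halfsign_flip (halfsign_flip_neq _ _ ij) ffunE (negPf ki) addbF !mulNr.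
Qed.

End Hypercube.

(** * Johnson graphs: counting subsets *)

Section Johnson.
Variables (R : realFieldType) (n k : nat).
Local Notation L := (johnson_lattice n k).
Implicit Types (x : johnson n k) (i j : 'I_n) (mu rho : L).

Lemma johnson_le_vertex (a : {y : {set 'I_n} | (#|y| <= k)%N}) x :
  ((Some a : L) <= @lvertex L x)%O = (val a \subset val x).
Proof. by []. Qed.

(** Complementation leads to the subsets of size [n - k] of the complement of [U]. Unlike a choice
    of [k - #|U|] elements with truncated subtraction, this gives 0 when [#|U| > k]. *)
Lemma card_johnson_supset (U : {set 'I_n}) : (k <= n)%N ->
  #|[set x : johnson n k | U \subset val x]| = 'C(n - #|U|, n - k).
Proof.
move=> kn; have cC (A : {set 'I_n}) : #|~: A| = (n - #|A|)%N.
  have e : (#|A| + #|~: A|)%N = n by rewrite cardsC card_ord.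
  by rewrite -[LHS](addKn #|A|) e.
rewrite -cC -cards_draws.
have inj : injective (fun x : johnson n k => ~: val x).
  by move=> x y /setC_inj/val_inj.
rewrite -(card_imset _ inj); congr #|pred_of_set _|; apply/setP => A.
rewrite inE; apply/imsetP/andP => [[x]|[AU /eqP cA]].
  by rewrite inE => Ux ->; rewrite setCS Ux cC (eqP (valP x)).
have kA : #|~: A| == k by rewrite cC cA subKn.
by exists (Sub (~: A) kA : johnson n k); rewrite /= ?setCK // inE /= subsetC.
Qed.

Lemma johnson_Lambda0 : Lambda R L 0 = <[cst L (1 : R)]>%VS.
Proof.
have d0 : (#|set0 : {set 'I_n}| <= k)%N by rewrite cards0.
pose z0 : L := Some (exist (fun y : {set 'I_n} => (#|y| <= k)%N) set0 d0).
apply: (@Lambda0_eq _ _ z0); first by rewrite inE /= cards0.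
case=> [[I dI]|] x; rewrite inE //= cards_eq0 => /eqP I0.
by rewrite johnson_le_vertex /= I0 sub0set.
Qed.

Lemma iotaf_johnson_top : iotaf R (None : L) = 0.
Proof. by apply/ffunP => x; rewrite !ffunE. Qed.

(** For [k = 0] no singleton is in the lattice, while the top has rank [k + 1 = 1]. *)
Lemma johnson_Omega1_k0 mu : k = 0%N -> mu \in Omega L 1 -> mu = None.
Proof.
case: mu => [[a /= ak]|] // k0; rewrite inE /= => /eqP a1.
by exfalso; move: (ak); rewrite a1 k0.
Qed.

Section PositiveRank.
Hypothesis k_gt0 : (0 < k)%N.

Fact johnson_atom_subproof i : (#|[set i]| <= k)%N.
Proof. by rewrite cards1. Qed.

Definition johnson_atom i : L :=
  Some (exist (fun y : {set 'I_n} => (#|y| <= k)%N) [set i] (johnson_atom_subproof i)).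

Lemma johnson_atom_le i x : (johnson_atom i <= @lvertex L x)%O = (i \in val x).
Proof. by rewrite johnson_le_vertex sub1set. Qed.

Lemma johnson_atom_inj : injective johnson_atom.
Proof. by move=> i j [] /set1_inj. Qed.

Lemma johnson_Omega1E : Omega L 1 = [set johnson_atom i | i in [set: 'I_n]].
Proof.
apply/setP => mu; rewrite inE; apply/idP/imsetP => [|[i _ ->]]; last first.
  by rewrite /= cards1.
case: mu => [[a /= ak]|/=]; last by rewrite eqSS eqn0Ngt k_gt0.
by case/cards1P => i ai; exists i; [rewrite inE|congr Some; apply/val_inj].
Qed.

Lemma johnson_atom_Omega i : johnson_atom i \in Omega L 1.
Proof. by rewrite johnson_Omega1E imset_f. Qed.

Lemma johnson_Omega1P mu : mu \in Omega L 1 -> exists i, mu = johnson_atom i.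
Proof. by rewrite johnson_Omega1E => /imsetP[i _]; exists i. Qed.

Lemma card_johnson_Omega1 : #|Omega L 1| = n.
Proof. by rewrite johnson_Omega1E card_imset ?cardsT ?card_ord //; exact: johnson_atom_inj. Qed.

Lemma johnson_sum_iota : \sum_(mu in Omega L 1) iotaf R mu = cst L k%:R.
Proof.
apply: sum_iota_card => x; congr (_%:R); rewrite -[RHS](eqP (valP x)).
rewrite -(card_imset _ johnson_atom_inj); congr #|pred_of_set _|.
apply/setP => mu; rewrite inE; apply/andP/imsetP => [[/johnson_Omega1P[i ->]]|[i ix ->]].
  by rewrite johnson_atom_le => ix; exists i.
by rewrite johnson_atom_Omega johnson_atom_le.
Qed.

Lemma johnson_fdot_iota mu : (k <= n)%N -> mu \in Omega L 1 ->
  fdot (cst L 1) (iotaf R mu) = 'C(n - 1, n - k)%:R.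
Proof.
move=> kn /johnson_Omega1P[i ->]; rewrite fdot1_iota_card -(cards1 i).
by rewrite -card_johnson_supset.
Qed.

Lemma johnson_fdot_iota2 mu rho : (k <= n)%N ->
  mu \in Omega L 1 -> rho \in Omega L 1 -> mu != rho ->
  fdot (iotaf R mu) (iotaf R rho) = 'C(n - 2, n - k)%:R.
Proof.
move=> kn /johnson_Omega1P[i ->] /johnson_Omega1P[j ->] ij.
have {}ij : i != j by apply: contra_neq ij => ->.
have c2 : #|[set i; j]| = 2%N by rewrite cards2 ij.
rewrite fdot_iota_card -c2 -card_johnson_supset //; congr (_%:R).
by apply: eq_card => x; rewrite !inE !johnson_atom_le subUset !sub1set.
Qed.

Lemma johnson_fdot_iota3 tau sigma rho : (k <= n)%N ->
  tau \in Omega L 1 -> sigma \in Omega L 1 -> tau != sigma ->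
  rho \in Omega L 1 -> ~~ (rho <= tau `|` sigma)%O ->
  fdot (iotaf R (tau `|` sigma)%O) (iotaf R rho) = 'C(n - 3, n - k)%:R.
Proof.
move=> kn /johnson_Omega1P[i ->] /johnson_Omega1P[j ->] ij /johnson_Omega1P[l ->] nle.
have {}ij : i != j by apply: contra_neq ij => ->.
have il : i != l by apply: contra nle => /eqP->; rewrite leUl.
have jl : j != l by apply: contra nle => /eqP->; rewrite leUr.
have c3 : #|[set i; j; l]| = 3%N.
  by rewrite setUC cardsU1 !inE cards2 ij negb_or eq_sym il eq_sym jl.
rewrite fdot_iota_card -c3 -card_johnson_supset //; congr (_%:R).
by apply: eq_card => x; rewrite !inE leUx !johnson_atom_le !subUset !sub1set.
Qed.

Lemma johnson_le_join tau sigma rho : (1 < k)%N ->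
  tau \in Omega L 1 -> sigma \in Omega L 1 -> rho \in Omega L 1 ->
  (rho <= tau `|` sigma)%O = (rho \in [set tau; sigma]).
Proof.
move=> k1 /johnson_Omega1P[i ->] /johnson_Omega1P[j ->] /johnson_Omega1P[l ->].
rewrite !inE; apply/idP/orP => [le_l|]; last first.
  by case=> /eqP->; rewrite ?leUl ?leUr.
have ijk : (#|[set i; j]| <= k)%N by rewrite cards2 (leq_trans _ k1) //; case: (_ != _).
(* As [k > 1], the pair [{i, j}] is an upper bound below the top. *)
pose w : L := Some (exist (fun y : {set 'I_n} => (#|y| <= k)%N) [set i; j] ijk).
have iw : (johnson_atom i <= w)%O by apply: subsetUl.
have jw : (johnson_atom j <= w)%O by apply: subsetUr.
have : (johnson_atom i `|` johnson_atom j <= w)%O by rewrite leUx iw jw.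
move/(le_trans le_l) => lw; have : [set l] \subset [set i; j] by [].
by rewrite sub1set !inE => /orP[]/eqP->; [left|right].
Qed.

End PositiveRank.

Lemma norton_check_johnson_sq (tau : L) : (k <= n)%N -> tau \in Omega L 1 ->
  norton (check R tau) (check R tau) = (1 - 2 * k%:R / n%:R) *: check R tau.
Proof.
move=> kn tauA; have [k0|k_gt0] := posnP k.
  rewrite (johnson_Omega1_k0 k0 tauA) check_iota0 ?iotaf_johnson_top ?norton0f ?scaler0 //.
rewrite (norton_check_sq johnson_Lambda0 (fun mu => @johnson_fdot_iota k_gt0 mu kn)
  (johnson_sum_iota k_gt0)) //.
by rewrite card_johnson_Omega1 // mulrA.
Qed.

Lemma norton_check_johnson_pair (tau sigma : L) : (2 * k <= n)%N ->
  tau \in Omega L 1 -> sigma \in Omega L 1 -> tau != sigma ->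
  norton (check R tau) (check R sigma)
    = ((2 * k%:R - n%:R) / (n%:R * (n%:R - 2))) *: (check R tau + check R sigma).
Proof.
move=> k2n tauA sigmaA ts; have [k0|k_gt0] := posnP k.
  by move: ts; rewrite (johnson_Omega1_k0 k0 tauA) (johnson_Omega1_k0 k0 sigmaA) eqxx.
have kn : (k <= n)%N by rewrite (leq_trans _ k2n) // leq_pmull.
have L0 := johnson_Lambda0; have sumK := johnson_sum_iota k_gt0.
have f1 mu := @johnson_fdot_iota k_gt0 mu kn.
have n0 : n%:R != 0 :> R by rewrite pnatr_eq0 -lt0n (leq_trans k_gt0).
rewrite (norton_check_pair L0 f1 sumK tauA sigmaA ts
  (fun mu rho => @johnson_fdot_iota2 k_gt0 mu rho kn)
  (fun rho => @johnson_fdot_iota3 k_gt0 tau sigma rho kn tauA sigmaA ts)).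
rewrite card_johnson_Omega1 //.
have sum2 : \sum_(rho in [set tau; sigma]) check R rho = check R tau + check R sigma.
  by rewrite big_setU1 ?inE //= big_set1.
(* For [n = 2] the denominator vanishes. Then [k = 1] and [tau], [sigma] are all the atoms, so their
   checks add up to the projection of a constant, 0. *)
have [n2|n2] := eqVneq n 2%N.
  have k1R : k%:R = 1 :> R by rewrite (_ : k = 1%N) //; lia.
  have <- : \sum_(mu in Omega L 1) check R mu = check R tau + check R sigma.
    have -> : Omega L 1 = [set tau; sigma].
      apply/esym/eqP; rewrite eqEcard card_johnson_Omega1 // cards2 ts (eq_leq n2) andbT.
      by apply/subsetP => mu; rewrite in_set2 => /orP[]/eqP->.
    exact: sum2.
  by rewrite -pi1_sum sumK (pi1_cst L0) !scaler0 k1R subrr mul0r scale0r addr0.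
have n2R : n%:R - 2 != 0 :> R by rewrite subr_eq0 eqr_nat.
(* For [k = 1] the join is the top, above all atoms, but the factor [K - 1 = 0] removes the sum. *)
have [k1|k1] := leqP k 1%N.
  have k1R : k%:R = 1 :> R by rewrite (_ : k = 1%N) //; lia.
  rewrite !k1R subrr mul0r scale0r addr0; congr (_ *: _); field; exact/andP.
have Bset : [set rho in Omega L 1 | (rho <= tau `|` sigma)%O] = [set tau; sigma].
  apply/setP => rho; rewrite inE; have [rhoA|rhoA] := boolP (rho \in _).
    exact: johnson_le_join.
  by apply/esym; apply: contraNF rhoA; rewrite in_set2 => /orP[]/eqP->.
have -> : \sum_(rho in Omega L 1 | (rho <= tau `|` sigma)%O) check R rho
    = check R tau + check R sigma.
  rewrite -sum2 -Bset; by apply: eq_bigl => rho; rewrite inE.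
(* Here [m = 2], and the coefficient is [-k/n + (k-1)/(n-2)]. *)
rewrite Bset cards2 ts -[(nat_of_bool true).+1]/2%N -scalerDl; congr (_ *: _); field; exact/andP.
Qed.

End Johnson.

(** * Counting points and subspaces of a finite vector space *)

Section Subspaces.
Variables (F : finFieldType) (V : vectType F).
Implicit Types (U W : {vspace V}).

Definition points W : {set {vspace V}} := [set p | (\dim p == 1%N) && (p <= W)%VS].

Lemma card_nonzero W :
  #|[set v : finvect_type V | ((v : V) \in W) && ((v : V) != 0)]| = (#|F| ^ \dim W - 1)%N.
Proof.
have <- : #|[set v : finvect_type V | (v : V) \in W]| = (#|F| ^ \dim W)%N.
  case: V W => T cT W; rewrite cardsE.
  exact: (@card_vspace F (finvect_type (Vector.Pack cT)) cT W).
rewrite [in RHS](cardsD1 ((0 : V) : finvect_type V)) inE mem0v add1n subn1 /=; apply: eq_card => v.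
by rewrite !inE andbC.
Qed.

(** Each nonzero vector of [W] spans one point, and each point contains [#|F| - 1] nonzero
    vectors. *)
Lemma card_points W : (#|points W| * (#|F| - 1) = #|F| ^ \dim W - 1)%N.
Proof.
rewrite -card_nonzero -sum1_card -[RHS]sum1_card big_distrl /=.
rewrite [RHS](partition_big (fun v : finvect_type V => <[v : V]>%VS)
  (mem (points W))) /= => [|v].
  apply: eq_bigr => p; rewrite inE => /andP[/eqP p1 pW].
  have -> : (#|F| - 1 = #|F| ^ \dim p - 1)%N by rewrite p1 expn1.
  rewrite mul1n -card_nonzero -sum1_card.
  apply: eq_bigl => v; rewrite !inE; apply/andP/andP => [[vp v0]|[/andP[vW v0] /eqP <-]].
    rewrite (subvP pW _ vp) v0; split=> //.
    by rewrite eqEdim -memvE vp dim_vline v0 p1.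
  by rewrite memv_line.
by rewrite !inE -memvE => /andP[vW v0]; rewrite dim_vline v0 vW.
Qed.

(** Bases of [U] and [W] are extended by bases of complements and matched in order; equal dimensions
    align the initial segments. *)
Lemma exists_automorphism U W : \dim U = \dim W ->
  exists2 f : 'End(V), injective f & (f @: U)%VS = W.
Proof.
move=> dUW; pose b (Y : {vspace V}) : seq V := vbasis Y ++ vbasis Y^C.
have bP Y : basis_of fullv (b Y).
  rewrite -(addv_complf Y); apply: cat_basis; rewrite ?vbasisP //.
  by apply/directv_addP; rewrite capv_compl.
have sb : size (b W) = size (b U).
  by rewrite -!(size_basis (X := in_tuple (b _)) (bP _)).
have [f fb] := linear_of_free (b U) (b W).
have {}fb : map (linfun f) (b U) = b W.
  by rewrite -fb ?(basis_free (bP U)) //; apply: eq_map => v; rewrite lfunE.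
exists (linfun f).
  apply/lker0P; rewrite -dimv_eq0 -(eqn_add2r (\dim (limg (linfun f)))).
  rewrite add0n -{1}(capfv (lker _)) limg_ker_dim.
  by rewrite -{2}(span_basis (bP U)) limg_span fb (span_basis (bP W)).
have /eqP := fb; rewrite map_cat eqseq_cat ?size_map ?size_tuple ?dUW //.
case/andP=> /eqP fU _.
by rewrite -{1}(span_basis (vbasisP U)) limg_span fU (span_basis (vbasisP W)).
Qed.

(** An automorphism taking [U] to [W] maps the vertices above [U] injectively to vertices above
    [W]. *)
Lemma card_grassmann_le k U W : \dim U = \dim W ->
  (#|[set x : grassmann V k | (U <= val x)%VS]|
    <= #|[set x : grassmann V k | (W <= val x)%VS]|)%N.
Proof.
move=> /exists_automorphism[f /lker0P f0 <-].
have dimf Y : \dim (f @: Y) = \dim Y by rewrite limg_dim_eq // (eqP f0) capv0.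
have fk (x : grassmann V k) : \dim (f @: val x) == k by rewrite dimf (valP x).
pose h (x : grassmann V k) : grassmann V k := Sub (f @: val x)%VS (fk x).
have h_inj : injective h.
  move=> x y [/(congr1 (fun Y => f^-1 @: Y)%VS)].
  by rewrite -!limg_comp lker0_compVf // !lim1g => /val_inj.
rewrite -(card_imset _ h_inj); apply/subset_leq_card/subsetP => y.
by case/imsetP=> x; rewrite !inE => Ux ->; rewrite /= limgS.
Qed.

(** Its value, a Gaussian binomial coefficient when [d <= k] and [d] is a dimension that occurs, is
    never computed: the general argument only needs a count depending on [d] alone. *)
Definition num_grassmann_above k d : nat :=
  let U := odflt 0%VS [pick U : {vspace V} | \dim U == d] in
  #|[set x : grassmann V k | (U <= val x)%VS]|.

Lemma card_grassmann_supset k U :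
  #|[set x : grassmann V k | (U <= val x)%VS]| = num_grassmann_above k (\dim U).
Proof.
rewrite /num_grassmann_above; case: pickP => [W /eqP dW|/(_ U)]; last by rewrite eqxx.
by apply/eqP; rewrite eqn_leq !card_grassmann_le.
Qed.

End Subspaces.

(** * Numbers of points as q-numbers *)

Section QNumbers.
Variables (R : realFieldType) (F : finFieldType) (V : vectType F).
Local Notation q := (#|F|%:R : R).

Lemma qcard_sub1_neq0 : q - 1 != 0.
Proof. by rewrite subr_eq0 (eqr_nat R _ 1) gtn_eqF // card_finNzRing_gt1. Qed.

(** At [i = 0] the quotient is 0, in agreement with the convention for [i < 1]. *)
Lemma qint_nat (r : R) (i : nat) : qint r i%:Z = (r ^+ i - 1) / (r - 1).
Proof. by case: i => [|i] //; rewrite expr0 subrr mul0r. Qed.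

Lemma natr_card_points (W : {vspace V}) :
  #|points W|%:R = qint q (\dim W)%:Z :> R.
Proof.
have q_gt0 : (0 < #|F|)%N by rewrite ltnW ?card_finNzRing_gt1.
rewrite qint_nat; apply: (mulIf qcard_sub1_neq0); rewrite divfK ?qcard_sub1_neq0 //.
have /(congr1 (fun i => i%:R : R)) := card_points W.
by rewrite natrM !natrB ?expn_gt0 ?q_gt0 // natrX.
Qed.

End QNumbers.

(** * Grassmann graphs: atoms as projective points *)

Section Grassmann.
Variables (R : realFieldType) (F : finFieldType) (V : vectType F) (k : nat).
Local Notation L := (grassmann_lattice V k).
Local Notation q := (#|F|%:R : R).
Implicit Types (x : grassmann V k) (p r W : {vspace V}) (mu rho : L).

Lemma grassmann_le_vertex (a : {y : {vspace V} | (\dim y <= k)%N}) x :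
  ((Some a : L) <= @lvertex L x)%O = (val a <= val x)%VS.
Proof. by []. Qed.

Lemma grassmann_joinE (a b : {y : {vspace V} | (\dim y <= k)%N}) :
  ((Some a : L) `|` (Some b : L))%O
    = (insub (val a + val b)%VS : option {y : {vspace V} | (\dim y <= k)%N}).
Proof. by []. Qed.

Lemma grassmann_Lambda0 : Lambda R L 0 = <[cst L (1 : R)]>%VS.
Proof.
have d0 : (\dim (0 : {vspace V}) <= k)%N by rewrite dimv0.
pose z0 : L := Some (exist (fun y : {vspace V} => (\dim y <= k)%N) 0%VS d0).
apply: (@Lambda0_eq _ _ z0); first by rewrite inE /= dimv0.
case=> [[I dI]|] x; rewrite inE //= dimv_eq0 => /eqP I0.
by rewrite grassmann_le_vertex /= I0 sub0v.
Qed.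

Lemma iotaf_grassmann_top : iotaf R (None : L) = 0.
Proof. by apply/ffunP => x; rewrite !ffunE. Qed.

Lemma grassmann_Omega1_k0 mu : k = 0%N -> mu \in Omega L 1 -> mu = None.
Proof.
case: mu => [[a /= ak]|] // k0; rewrite inE /= => /eqP a1.
by exfalso; move: (ak); rewrite a1 k0.
Qed.

Section PositiveRank.
Hypothesis k_gt0 : (0 < k)%N.

(** [insub] makes the map total, with the top as value on subspaces of dimension above [k]. *)
Definition grassmann_atom p : L := insub p.

Lemma grassmann_atomE p : p \in points fullv ->
  {pk : (\dim p <= k)%N |
    grassmann_atom p = Some (exist (fun y : {vspace V} => (\dim y <= k)%N) p pk)}.
Proof.
rewrite inE => /andP[/eqP p1 _]; have pk : (\dim p <= k)%N by rewrite p1.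
by exists pk; rewrite /grassmann_atom insubT.
Qed.

Lemma grassmann_atom_le p x : p \in points fullv ->
  (grassmann_atom p <= @lvertex L x)%O = (p <= val x)%VS.
Proof. by case/grassmann_atomE => pk ->. Qed.

Lemma grassmann_atom_inj : {in points fullv &, injective grassmann_atom}.
Proof. by move=> p r /grassmann_atomE[pk ->] /grassmann_atomE[rk ->] []. Qed.

Lemma grassmann_Omega1E : Omega L 1 = [set grassmann_atom p | p in points fullv].
Proof.
apply/setP => mu; rewrite inE; apply/idP/imsetP => [|[p pP ->]]; last first.
  by have [pk ->] := grassmann_atomE pP; move: pP; rewrite /= !inE => /andP[].
case: mu => [[a /= ak] a1|/=]; last by rewrite eqSS eqn0Ngt k_gt0.
have aP : a \in points fullv by rewrite inE a1 subvf.
exists a => //; case: (grassmann_atomE aP) => pk ->; congr Some; exact: val_inj.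
Qed.

Lemma grassmann_atom_Omega p : p \in points fullv -> grassmann_atom p \in Omega L 1.
Proof. by move=> pP; rewrite grassmann_Omega1E imset_f. Qed.

Lemma grassmann_Omega1P mu : mu \in Omega L 1 ->
  exists2 p, p \in points fullv & mu = grassmann_atom p.
Proof. by rewrite grassmann_Omega1E => /imsetP. Qed.

Lemma card_grassmann_Omega1 : #|Omega L 1|%:R = qint q (\dim {:V})%:Z :> R.
Proof.
rewrite -natr_card_points grassmann_Omega1E card_in_imset //.
exact: grassmann_atom_inj.
Qed.

(** Serves twice: with [W] a vertex it yields [K], with [W] the sum of two points it yields [m]. *)
Lemma card_grassmann_atoms (B : {set L}) W : B \subset Omega L 1 ->
  (forall p, p \in points fullv -> (grassmann_atom p \in B) = (p <= W)%VS) ->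
  #|B|%:R = qint q (\dim W)%:Z :> R.
Proof.
move=> /subsetP BA BW; rewrite -natr_card_points; congr (_%:R).
have inj : {in points W &, injective grassmann_atom}.
  move=> p r; rewrite !inE => /andP[p1 _] /andP[r1 _].
  by apply: grassmann_atom_inj; rewrite inE subvf andbT.
rewrite -(card_in_imset inj); congr #|pred_of_set _|; apply/setP => mu.
apply/idP/imsetP => [muB|[p]]; last first.
  by rewrite inE => /andP[p1 pW] ->; rewrite BW // inE p1 subvf.
have /grassmann_Omega1P[p pP e] := BA _ muB; exists p => //.
by move: (pP) muB; rewrite e BW // !inE => /andP[-> _] ->.
Qed.

Lemma grassmann_sum_iota :
  \sum_(mu in Omega L 1) iotaf R mu = cst L (qint q k%:Z).
Proof.
apply: sum_iota_card => x; rewrite -[k in RHS](eqP (valP x)).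
apply: card_grassmann_atoms => [|p pP]; first by apply/subsetP => mu; rewrite inE => /andP[].
by rewrite inE grassmann_atom_Omega // grassmann_atom_le.
Qed.

Lemma grassmann_fdot_iota mu : mu \in Omega L 1 ->
  fdot (cst L 1) (iotaf R mu) = (num_grassmann_above V k 1%N)%:R.
Proof.
move=> /grassmann_Omega1P[p pP ->].
have p1 : \dim p = 1%N by move: pP; rewrite inE => /andP[/eqP].
rewrite fdot1_iota_card -p1 -card_grassmann_supset; congr (_%:R).
by apply: eq_card => x; rewrite !inE grassmann_atom_le.
Qed.

Lemma dim_add_point p W : \dim p = 1%N -> ~~ (p <= W)%VS ->
  \dim (W + p) = (\dim W).+1.
Proof.
move=> p1 npW; rewrite dimv_disjoint_sum ?p1 ?addn1 //.
apply/eqP; rewrite -dimv_eq0 -leqn0 leqNgt; apply: contra npW => dWp.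
have /eqP <- : (W :&: p == p)%VS by rewrite eqEdim capvSr p1.
exact: capvSl.
Qed.

Lemma dim_add_points p r : \dim p = 1%N -> \dim r = 1%N -> p != r ->
  \dim (p + r) = 2%N.
Proof.
move=> p1 r1 pr; rewrite dim_add_point ?p1 //; apply: contra pr => rp.
by rewrite eq_sym eqEdim rp p1 r1.
Qed.

Lemma grassmann_fdot_iota2 mu rho :
  mu \in Omega L 1 -> rho \in Omega L 1 -> mu != rho ->
  fdot (iotaf R mu) (iotaf R rho) = (num_grassmann_above V k 2%N)%:R.
Proof.
move=> /grassmann_Omega1P[p pP ->] /grassmann_Omega1P[r rP ->] pr.
have {}pr : p != r by apply: contra_neq pr => ->.
have p1 : \dim p = 1%N by move: pP; rewrite inE => /andP[/eqP].
have r1 : \dim r = 1%N by move: rP; rewrite inE => /andP[/eqP].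
rewrite fdot_iota_card -(dim_add_points p1 r1 pr) -card_grassmann_supset.
by congr (_%:R); apply: eq_card => x; rewrite !inE !grassmann_atom_le // subv_add.
Qed.

(** If [p + r] has dimension above [k], the join is the top, above every atom; hence the
    implication. *)
Lemma grassmann_le_join p r W : p \in points fullv -> r \in points fullv ->
  W \in points fullv ->
  (grassmann_atom W <= grassmann_atom p `|` grassmann_atom r)%O
    = (\dim (p + r) <= k)%N ==> (W <= p + r)%VS.
Proof.
move=> /grassmann_atomE[pk ->] /grassmann_atomE[rk ->] /grassmann_atomE[Wk ->].
rewrite grassmann_joinE /=.
by case: insubP => [u /= -> <-|/= /negPf->].
Qed.

Lemma grassmann_fdot_iota3 tau sigma rho :
  tau \in Omega L 1 -> sigma \in Omega L 1 -> tau != sigma ->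
  rho \in Omega L 1 -> ~~ (rho <= tau `|` sigma)%O ->
  fdot (iotaf R (tau `|` sigma)%O) (iotaf R rho) = (num_grassmann_above V k 3%N)%:R.
Proof.
move=> /grassmann_Omega1P[p pP ->] /grassmann_Omega1P[r rP ->] pr.
have {}pr : p != r by apply: contra_neq pr => ->.
move=> /grassmann_Omega1P[W WP ->].
(* The join is not the top here, so the third point lies outside [p + r]. *)
rewrite grassmann_le_join // negb_imply => /andP[_ nle].
have p1 : \dim p = 1%N by move: pP; rewrite inE => /andP[/eqP].
have r1 : \dim r = 1%N by move: rP; rewrite inE => /andP[/eqP].
have W1 : \dim W = 1%N by move: WP; rewrite inE => /andP[/eqP].
have d3 : \dim (p + r + W) = 3%N by rewrite dim_add_point // dim_add_points.
rewrite fdot_iota_card -d3 -card_grassmann_supset; congr (_%:R).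
by apply: eq_card => x; rewrite !inE leUx !grassmann_atom_le // !subv_add.
Qed.

Lemma card_grassmann_le_join tau sigma : (1 < k)%N ->
  tau \in Omega L 1 -> sigma \in Omega L 1 -> tau != sigma ->
  #|[set rho in Omega L 1 | (rho <= tau `|` sigma)%O]|%:R = qint q 2 :> R.
Proof.
move=> k_gt1 /grassmann_Omega1P[p pP ->] /grassmann_Omega1P[r rP ->] pr.
have {}pr : p != r by apply: contra_neq pr => ->.
have p1 : \dim p = 1%N by move: pP; rewrite inE => /andP[/eqP].
have r1 : \dim r = 1%N by move: rP; rewrite inE => /andP[/eqP].
rewrite (@card_grassmann_atoms _ (p + r)%VS) ?dim_add_points //.
  by apply/subsetP => mu; rewrite inE => /andP[].
move=> W WP; rewrite inE grassmann_atom_Omega // grassmann_le_join //.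
by rewrite dim_add_points // k_gt1.
Qed.

End PositiveRank.

Lemma norton_check_grassmann_sq (tau : L) : tau \in Omega L 1 ->
  norton (check R tau) (check R tau)
    = (1 - 2 * qint q k%:Z / qint q (\dim {:V})%:Z) *: check R tau.
Proof.
move=> tauA; have [k0|k_gt0] := posnP k.
  by rewrite (grassmann_Omega1_k0 k0 tauA) check_iota0 ?iotaf_grassmann_top
    ?norton0f ?scaler0 //.
rewrite (norton_check_sq grassmann_Lambda0 (grassmann_fdot_iota k_gt0)
  (grassmann_sum_iota k_gt0)) //.
by rewrite card_grassmann_Omega1 // mulrA.
Qed.

Lemma norton_check_grassmann_pair (tau sigma : L) :
  tau \in Omega L 1 -> sigma \in Omega L 1 -> tau != sigma ->
  norton (check R tau) (check R sigma)
    = - (qint q k%:Z / qint q (\dim {:V})%:Z) *: (check R tau + check R sigma)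
      + (qint q (k%:Z - 1) / (q * qint q ((\dim {:V})%:Z - 2)))
          *: \sum_(rho in Omega L 1 | (rho <= tau `|` sigma)%O) check R rho.
Proof.
move=> tauA sigmaA ts; have [k0|k_gt0] := posnP k.
  by move: ts; rewrite (grassmann_Omega1_k0 k0 tauA) (grassmann_Omega1_k0 k0 sigmaA) eqxx.
rewrite (norton_check_pair grassmann_Lambda0 (grassmann_fdot_iota k_gt0)
  (grassmann_sum_iota k_gt0) tauA sigmaA ts (grassmann_fdot_iota2 k_gt0)
  (fun rho => @grassmann_fdot_iota3 k_gt0 tau sigma rho tauA sigmaA ts)).
rewrite card_grassmann_Omega1 //; congr (_ + _ *: _).
(* For [k = 1] both numerators, [[1]_q - 1] and [[0]_q], vanish. *)
have [k_gt1|k_le1] := ltnP 1 k; last first.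
  have k1 : k = 1%N by lia.
  have -> : qint q k%:Z - 1 = 0 by rewrite k1 qint_nat expr1 divff ?subrr ?qcard_sub1_neq0.
  by rewrite [in RHS](_ : k%:Z - 1 = 0) ?mul0r // k1.
rewrite card_grassmann_le_join //.
(* Two distinct points force dimension at least 2. *)
have [d dimV] : {d | \dim {:V} = d.+2}.
  exists (\dim {:V} - 2)%N; suff : (1 < \dim {:V})%N by lia.
  have [p pP etau] := grassmann_Omega1P k_gt0 tauA.
  have [r rP esigma] := grassmann_Omega1P k_gt0 sigmaA.
  rewrite -(@dim_add_points p r) ?dimvS ?subvf //.
  - by move: pP; rewrite inE => /andP[/eqP].
  - by move: rP; rewrite inE => /andP[/eqP].
  - by apply: contra_neq ts; rewrite etau esigma => ->.
rewrite dimV; have [l ->] : {l | k = l.+1} by exists k.-1; lia.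
have -> : l.+1%:Z - 1 = l%:Z by lia.
have -> : d.+2%:Z - 2 = d%:Z by lia.
have q1 := qcard_sub1_neq0 R F.
have q0 : q != 0 by rewrite pnatr_eq0 -lt0n ltnW ?card_finNzRing_gt1.
(* One factor [q] cancels between [q [l]_q] and [[d+2]_q - [2]_q = q^2 [d]_q]. For [d = 0] both
   denominators are 0, and so are both quotients. *)
have -> : qint q l.+1 - 1 = q * qint q l.
  by rewrite !qint_nat exprS; field.
have -> : qint q d.+2 - qint q 2 = q * (q * qint q d).
  by rewrite !qint_nat !exprS expr0; field.
by rewrite -mulf_div divff // mul1r.
Qed.

End Grassmann.

Theorem theorem6p6 (R : realType) :
  [/\ (* (i) *)
      forall (n : nat) (tau sigma : hypercube_lattice n),
        tau \in Omega (hypercube_lattice n) 1 ->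
        sigma \in Omega (hypercube_lattice n) 1 ->
        norton (check R tau) (check R sigma) = 0,
      (* (ii) *)
      (forall (n k : nat) (tau : johnson_lattice n k),
        (2 * k <= n)%N ->
        tau \in Omega (johnson_lattice n k) 1 ->
        norton (check R tau) (check R tau)
          = (1 - 2 * k%:R / n%:R) *: check R tau)
      /\
      (forall (F : finFieldType) (V : vectType F) (n k : nat)
          (tau : grassmann_lattice V k),
        \dim {:V} = n ->
        tau \in Omega (grassmann_lattice V k) 1 ->
        let q : R := #|F|%:R in
        norton (check R tau) (check R tau)
          = (1 - 2 * qint q k%:Z / qint q n%:Z) *: check R tau)
    & (* (iii) *)
      (forall (n k : nat) (tau sigma : johnson_lattice n k),
        (2 * k <= n)%N ->
        tau \in Omega (johnson_lattice n k) 1 ->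
        sigma \in Omega (johnson_lattice n k) 1 ->
        tau != sigma ->
        norton (check R tau) (check R sigma)
          = ((2 * k%:R - n%:R) / (n%:R * (n%:R - 2)))
              *: (check R tau + check R sigma))
      /\
      (forall (F : finFieldType) (V : vectType F) (n k : nat)
          (tau sigma : grassmann_lattice V k),
        \dim {:V} = n ->
        tau \in Omega (grassmann_lattice V k) 1 ->
        sigma \in Omega (grassmann_lattice V k) 1 ->
        tau != sigma ->
        let q : R := #|F|%:R in
        norton (check R tau) (check R sigma)
          = - (qint q k%:Z / qint q n%:Z) *: (check R tau + check R sigma)
            + (qint q (k%:Z - 1) / (q * qint q (n%:Z - 2)))
                *: \sum_(rho in Omega (grassmann_lattice V k) 1
                          | (rho <= tau `|` sigma)%O) check R rho)].
Proof.
split; first exact: norton_check_hypercube.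
- split=> [n k tau k2n|F V n k tau <-].
    by apply: norton_check_johnson_sq; rewrite (leq_trans _ k2n) ?leq_pmull.
  exact: norton_check_grassmann_sq.
- split=> [n k tau sigma|F V n k tau sigma <-].
    exact: norton_check_johnson_pair.
  exact: norton_check_grassmann_pair.
Qed.
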